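(* Let $\Phi$ be a linear Monotone NAE-4-SAT instance with $m\ge1$ clauses $C_1,\dots,C_m$, and let $G$ be the simple unweighted graph obtained from $\Phi$ by the $K_6$ construction. Then $$\operatorname{SDP}(G)=9m,\qquad \operatorname{MC}(G)=8m+\operatorname{OPT}_{\mathrm{NAE}}(\Phi),$$ and hence $$\operatorname{SDP}(G)-\operatorname{MC}(G)=m-\operatorname{OPT}_{\mathrm{NAE}}(\Phi).$$ In particular, $\operatorname{SDP}(G)=\operatorname{MC}(G)$ if and only if $\Phi$ is satisfiable.
   Context: A Monotone NAE-4-SAT instance consists of a finite set of Boolean variables and a finite collection of distinct clauses, each a set of four distinct (unnegated) variables. A clause is satisfied by an assignment when its four variables are not all assigned the same value; the instance is satisfiable if some assignment satisfies all clauses. It is linear if any two distinct clauses share at most one variable. $\operatorname{OPT}_{\mathrm{NAE}}(\Phi)$ is the maximum, over Boolean assignments of the variables, of the number of satisfied clauses. $K_6$ construction: the vertices of $G$ are the variables of $\Phi$ together with, for each clause $C_j$, two new private auxiliary vertices $d_{j,1},d_{j,2}$. The edge set of $G$ is the union over $j=1,\dots,m$ of the edge sets of the complete graph $K_6$ on the six vertices $C_j\cup\{d_{j,1},d_{j,2}\}$ (these are edge-disjoint by linearity). For a simple unweighted graph $G$ with $0/1$ adjacency matrix $W$ on $N$ vertices, $$\operatorname{MC}(G)=\max_{x\in\{-1,1\}^N}\frac14\sum_{i\ne j}W_{ij}(1-x_ix_j),\qquad \operatorname{SDP}(G)=\max_{X\succeq0,\ X_{ii}=1}\frac14\sum_{i\ne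 j}W_{ij}(1-X_{ij}),$$ where sums are over ordered pairs of distinct vertices and $X$ ranges over real symmetric $N\times N$ matrices. *)

(* Defs.v *)
From mathcomp Require Import all_boot all_order all_algebra.
From mathcomp Require Import boolp classical_sets reals.
Set Implicit Arguments.
Unset Strict Implicit.
Unset Printing Implicit Defensive.
Import Order.TTheory GRing.Theory Num.Theory.
Local Open Scope ring_scope.

Record nae4sat (V : finType) (m : nat) := Nae4sat {
  clause :> 'I_m -> {set V};
  clause_inj : injective clause;
  card_clause : forall j, #|clause j| = 4%N }.

Definition linear_inst (V : finType) (m : nat) (Phi : nae4sat V m) : Prop :=
  forall i j, i != j -> (#|Phi i :&: Phi j| <= 1)%N.

Definition nae_sat (V : finType) (a : {ffun V -> bool}) (C : {set V}) : bool :=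
  ~~ [exists b : bool, [forall v in C, a v == b]].

Definition satisfiable (V : finType) (m : nat) (Phi : nae4sat V m) : Prop :=
  exists a : {ffun V -> bool}, forall j, nae_sat a (Phi j).

Definition OPT_NAE (V : finType) (m : nat) (Phi : nae4sat V m) : nat :=
  (\max_(a : {ffun V -> bool}) #|[set j | nae_sat a (Phi j)]|)%N.

Record sgraph (T : finType) := SGraph {
  edge :> rel T;
  edge_sym : symmetric edge;
  edge_irr : irreflexive edge }.

Definition adjmx (R : realType) (T : finType) (G : sgraph T) : 'M[R]_#|T| :=
  \matrix_(i, j) (G (enum_val i) (enum_val j))%:R.

(* The greatest element of A, with junk value 0 if A has none.  A nonzero
   value is therefore always attained in A. *)
Definition set_max (R : realType) (A : set R) : R :=
  xget 0 (A `&` ubound A)%classic.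

Lemma set_maxP (R : realType) (A : set R) (v : R) :
  A v -> ubound A v -> set_max A = v.
Proof.
move=> Av uv; apply: xget_unique => // w [Aw uw].
by apply/eqP; rewrite eq_le (uv _ Aw) (uw _ Av).
Qed.

Definition sdp_obj (R : realType) (n : nat) (W X : 'M[R]_n) : R :=
  4^-1 * \sum_i \sum_(j | j != i) W i j * (1 - X i j).

Definition cut_obj (R : realType) (n : nat) (W : 'M[R]_n) (x : 'rV[R]_n) : R :=
  4^-1 * \sum_i \sum_(j | j != i) W i j * (1 - x 0 i * x 0 j).

Definition psdmx (R : realType) (n : nat) (X : 'M[R]_n) : Prop :=
  X^T = X /\ forall z : 'cV[R]_n, 0 <= (z^T *m X *m z) 0 0.

Definition MC (R : realType) (T : finType) (G : sgraph T) : R :=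
  set_max [set cut_obj (adjmx R G) x | x in
    [set x : 'rV[R]_#|T| | forall i, x 0 i = -1 \/ x 0 i = 1]]%classic.

Definition SDP (R : realType) (T : finType) (G : sgraph T) : R :=
  set_max [set sdp_obj (adjmx R G) X | X in
    [set X : 'M[R]_#|T| | psdmx X /\ forall i, X i i = 1]]%classic.

(* inr (j, k) is the k-th private vertex of clause j. *)

Definition K6_vertex (V : finType) (m : nat) : finType :=
  (V + 'I_m * 'I_2)%type.

Definition K6_block (V : finType) (m : nat) (Phi : nae4sat V m) (j : 'I_m) :
    {set K6_vertex V m} :=
  [set inl v | v in Phi j] :|: [set inr (j, k) | k : 'I_2].

Definition K6_edge (V : finType) (m : nat) (Phi : nae4sat V m) :
    rel (K6_vertex V m) :=
  fun u v => [exists j, [&& u \in K6_block Phi j, v \in K6_block Phi j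
                          & u != v]].

Lemma K6_edge_sym (V : finType) (m : nat) (Phi : nae4sat V m) :
  symmetric (K6_edge Phi).
Proof.
by move=> u v; apply: eq_existsb => j; rewrite andbCA eq_sym.
Qed.

Lemma K6_edge_irr (V : finType) (m : nat) (Phi : nae4sat V m) :
  irreflexive (K6_edge Phi).
Proof. by move=> u; apply/existsP => -[j]; rewrite eqxx !andbF. Qed.

Definition K6_graph (V : finType) (m : nat) (Phi : nae4sat V m) :
    sgraph (K6_vertex V m) :=
  SGraph (K6_edge_sym Phi) (K6_edge_irr Phi).

(* Main.v *)
Require Import Defs.
From mathcomp Require Import all_boot all_order all_algebra.
From mathcomp Require Import reals.
From mathcomp Require Import ring lra.
Set Implicit Arguments.
Unset Strict Implicit.
Unset Printing Implicit Defensive.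
Import Order.TTheory GRing.Theory Num.Theory.
Local Open Scope ring_scope.

(** Linearity makes the six-vertex blocks edge-disjoint, so both objectives
    split into a sum over the clauses ([sdp_obj_K6], [cut_obj_K6]): a block B
    contributes 9 - q / 4, where q is the sum of all entries of X indexed by
    B x B.  For a cut x, X is the rank-one matrix of the x_i x_j and q is the
    square of the sum of x over B.

    Semidefiniteness gives q >= 0, hence SDP <= 9m.  Equality in all blocks
    at once is achieved by the Gram matrix of unit vectors ([K6_vector]) that
    sum to zero over each block: variables get orthonormal vectors, and both
    private vertices of a clause get minus half the sum of its four variable
    vectors, which is again a unit vector.

    For a cut, if k of the four variables of a clause are on the positive
    side, they sum to 2k - 4.  The two private signs add -2, 0 or 2, so they
    can bring the block sum to 0 exactly when 0 < k < 4, that is, when the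
    clause is NAE-satisfied; otherwise the block sum has absolute value at
    least 2, and 2 is reached.  So a block cuts at most 9 edges if its clause
    is satisfied and at most 8 if not ([block_sum_sqr_ge]), and the private
    vertices can be placed to meet this bound independently in every block
    ([block_sum_balanced]).  Hence MC = 8m + OPT, and the gap m - OPT
    vanishes exactly when some assignment satisfies all m clauses. *)

(** * Blocks and edge-disjointness *)

Lemma sum_enum_rank (R : nmodType) (T : finType) (P : pred 'I_#|T|)
    (F : 'I_#|T| -> R) :
  \sum_(i | P i) F i = \sum_(u | P (enum_rank u)) F (enum_rank u).
Proof. by apply: reindex; apply: onW_bij; apply: enum_rank_bij. Qed.

Lemma K6_block_inl (V : finType) (m : nat) (Phi : nae4sat V m) j v :
  (inl v \in K6_block Phi j) = (v \in Phi j).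
Proof.
rewrite !inE mem_imset; last by move=> ? ? [].
by case: imsetP => [[]|_] //; rewrite orbF.
Qed.

Lemma K6_block_inr (V : finType) (m : nat) (Phi : nae4sat V m) j i k :
  (inr (i, k) \in K6_block Phi j) = (i == j).
Proof.
rewrite !inE; case: imsetP => [[]|_] //=.
by apply/imsetP/eqP => [[k' _ [->]]|->] //; exists k.
Qed.

Lemma sum_K6_block (R : nmodType) (V : finType) (m : nat)
    (Phi : nae4sat V m) j (F : K6_vertex V m -> R) :
  \sum_(u in K6_block Phi j) F u =
    \sum_(v in Phi j) F (inl v) + (F (inr (j, ord0)) + F (inr (j, ord_max))).
Proof.
rewrite big_sumType /=; congr (_ + _).
  by apply: eq_bigl => v; rewrite K6_block_inl.
rewrite (eq_big (fun p : 'I_m * 'I_2 => (p.1 == j) && true)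
                (fun p => F (inr (p.1, p.2)))); first last.
- by case.
- by case=> i k; rewrite K6_block_inr andbT.
rewrite -(pair_big (fun i => i == j) xpredT (fun i k => F (inr (i, k)))) /=.
rewrite big_pred1_eq big_ord_recl big_ord1.
by congr (_ + F (inr (_, _))); apply: val_inj.
Qed.

(** At most one block contains both ends of an edge: a private vertex lies in a
    single block, and two variables lie together in at most one clause by
    linearity. *)
Lemma K6_edge_sum (R : nzSemiRingType) (V : finType) (m : nat)
    (Phi : nae4sat V m) (linPhi : linear_inst Phi) u v : u != v ->
  (K6_edge Phi u v)%:R =
    \sum_j ((u \in K6_block Phi j) && (v \in K6_block Phi j))%:R :> R.
Proof.
move=> uv.
have uniqB i j : u \in K6_block Phi i -> v \in K6_block Phi i ->
    u \in K6_block Phi j -> v \in K6_block Phi j -> i = j.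
  case: u v uv => [u|[iu ku]] [v|[iv kv]]; rewrite ?K6_block_inl ?K6_block_inr.
  - move=> uv ui vi uj vj; apply/eqP/negPn/negP => /linPhi.
    rewrite leqNgt => /negP; apply; apply: leq_trans (subset_leq_card _).
      suff <- : #|[set u; v]| = 2%N by [].
      by rewrite cards2 -(inj_eq (@inl_inj _ ('I_m * 'I_2)%type)) uv.
    by apply/subsetP => w /set2P[]->; rewrite inE; apply/andP.
  - by move=> _ _ /eqP<- _ /eqP<-.
  - by move=> _ /eqP<- _ /eqP<-.
  - by move=> _ /eqP<- _ /eqP<-.
case: (boolP (K6_edge Phi u v)) => [/existsP[i /and3P[ui vi _]]|noE].
  rewrite (bigD1 i) //= ui vi big1 ?addr0 // => j ji.
  case: (boolP (_ && _)) => // /andP[uj vj].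
  by rewrite (uniqB j i) ?eqxx in ji.
rewrite big1 // => j _; case: (boolP (_ && _)) => // /andP[uj vj].
by case/negP: noE; apply/existsP; exists j; rewrite uj vj.
Qed.

(** The unit diagonal kills the summands with u = v, so the sum over the edges
    of a block may be taken over all 36 ordered pairs of its vertices. *)
Lemma sdp_obj_K6 (R : realType) (V : finType) (m : nat)
    (Phi : nae4sat V m) (linPhi : linear_inst Phi)
    (X : 'M[R]_#|K6_vertex V m|) (X1 : forall i, X i i = 1) :
  sdp_obj (adjmx R (K6_graph Phi)) X =
    \sum_j (9 - 4^-1 * \sum_(u in K6_block Phi j) \sum_(v in K6_block Phi j)
                         X (enum_rank u) (enum_rank v)).
Proof.
have cardB j : \sum_(u in K6_block Phi j) (1 : R) = 6.
  by rewrite sum_K6_block sumr_const card_clause; ring.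
have -> : sdp_obj (adjmx R (K6_graph Phi)) X =
    4^-1 * \sum_u \sum_v \sum_j
      ((u \in K6_block Phi j) && (v \in K6_block Phi j))%:R
        * (1 - X (enum_rank u) (enum_rank v)).
  congr (_ * _); rewrite sum_enum_rank; apply: eq_bigr => u _.
  rewrite [RHS](bigD1 u) //= [X in X + _]big1 ?add0r; last first.
    by move=> j _; rewrite X1 subrr mulr0.
  rewrite sum_enum_rank.
  apply: eq_big => [v|v]; first by rewrite (inj_eq enum_rank_inj).
  rewrite (inj_eq enum_rank_inj) eq_sym => uv.
  by rewrite mxE !enum_rankK /= (K6_edge_sum _ linPhi uv) mulr_suml.
under eq_bigr do rewrite exchange_big /=.
rewrite exchange_big /= mulr_sumr; apply: eq_bigr => j _.
rewrite (_ : 9 = 4^-1 * \sum_(u in K6_block Phi j)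
                           \sum_(v in K6_block Phi j) (1 : R)); last first.
  under eq_bigr do rewrite cardB -[6]mul1r.
  rewrite -mulr_suml cardB; lra.
rewrite -mulrBr -sumrB; congr (_ * _); rewrite [RHS]big_mkcond.
apply: eq_bigr => u _; case: ifP => /= uB; last first.
  by rewrite big1 // => v _; rewrite mul0r.
rewrite -sumrB [RHS]big_mkcond; apply: eq_bigr => v _.
by case: ifP => _; rewrite ?mul1r ?mul0r.
Qed.

(** * The semidefinite value *)

(** Test semidefiniteness on the indicator vector of A. *)
Lemma psdmx_sum_ge0 (R : realType) (T : finType) (X : 'M[R]_#|T|)
    (A : {set T}) : psdmx X ->
  0 <= \sum_(u in A) \sum_(v in A) X (enum_rank u) (enum_rank v).
Proof.
case=> _ /(_ (\col_i (enum_val i \in A)%:R)); congr (0 <= _).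
rewrite mxE sum_enum_rank /= exchange_big [RHS]big_mkcond; apply: eq_bigr => v _.
rewrite !mxE enum_rankK; case: ifP => _; rewrite ?mulr0 // mulr1.
rewrite sum_enum_rank [RHS]big_mkcond; apply: eq_bigr => u _.
by rewrite !mxE enum_rankK; case: ifP => _; rewrite ?mul0r ?mul1r.
Qed.

Lemma psdmx_gram (R : realType) (n : nat) (T : finType) (f : 'I_n -> T -> R) :
  psdmx (\matrix_(i, j) \sum_t f i t * f j t).
Proof.
split=> [|z].
  by apply/matrixP => i j; rewrite !mxE; apply: eq_bigr => t _; rewrite mulrC.
suff -> : (z^T *m (\matrix_(i, j) \sum_t f i t * f j t) *m z) 0 0 =
    \sum_t (\sum_i z i 0 * f i t) ^+ 2.
  by apply: sumr_ge0 => t _; apply: sqr_ge0.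
rewrite mxE; under eq_bigr => j _.
  rewrite mxE mulr_suml.
  under eq_bigr => i _ do rewrite !mxE mulr_sumr mulr_suml.
  over.
rewrite /= exchange_big /=.
under eq_bigr do rewrite exchange_big /=.
rewrite exchange_big /=; apply: eq_bigr => t _.
rewrite expr2 mulr_suml; apply: eq_bigr => i _.
by rewrite mulr_sumr; apply: eq_bigr => j _; ring.
Qed.

Lemma sum_gram (R : comNzRingType) (I T : finType) (A : {set I})
    (f : I -> T -> R) :
  \sum_(u in A) \sum_(v in A) \sum_t f u t * f v t =
    \sum_t (\sum_(u in A) f u t) ^+ 2.
Proof.
under eq_bigr do rewrite exchange_big /=.
rewrite exchange_big /=; apply: eq_bigr => t _.
by rewrite expr2 mulr_suml; apply: eq_bigr => u _; rewrite mulr_sumr.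
Qed.

(** The vectors are given by their coordinates in an orthonormal basis indexed
    by the variables; the factor 1/2 makes a sum of four basis vectors unit. *)
Definition K6_vector (R : fieldType) (V : finType) (m : nat)
    (Phi : nae4sat V m) (u : K6_vertex V m) (t : V) : R :=
  match u with
  | inl v => (t == v)%:R
  | inr (j, _) => - 2^-1 * (t \in Phi j)%:R
  end.

Lemma K6_vector_unit (R : realType) (V : finType) (m : nat)
    (Phi : nae4sat V m) u :
  \sum_t K6_vector R Phi u t * K6_vector R Phi u t = 1.
Proof.
case: u => [v|[j k]] /=.
  rewrite (bigD1 v) //= eqxx mulr1 big1 ?addr0 // => t /negbTE->.
  by rewrite mulr0.
rewrite (eq_bigr (fun t => 4^-1 * (t \in Phi j)%:R)) => [|t _].
  by rewrite -mulr_sumr -natr_sum -big_mkcond sum1_card card_clause; lra.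
by case: (t \in _) => /=; lra.
Qed.

Lemma K6_vector_sum0 (R : realType) (V : finType) (m : nat)
    (Phi : nae4sat V m) j t :
  \sum_(u in K6_block Phi j) K6_vector R Phi u t = 0.
Proof.
rewrite sum_K6_block /=.
have -> : \sum_(v in Phi j) (t == v)%:R = (t \in Phi j)%:R :> R.
  case: (boolP (t \in Phi j)) => tj.
    rewrite (bigD1 t) //= eqxx big1 ?addr0 // => v /andP[_].
    by rewrite eq_sym => /negbTE->.
  by rewrite big1 // => v vj; case: eqP => // tv; rewrite tv vj in tj.
lra.
Qed.

Lemma SDP_K6 (R : realType) (V : finType) (m : nat)
    (Phi : nae4sat V m) (linPhi : linear_inst Phi) :
  SDP R (K6_graph Phi) = 9 * m%:R.
Proof.
have sum9 : \sum_(j < m) 9 = 9 * m%:R :> R by rewrite sumr_const card_ord mulr_natr.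
apply: set_maxP.
  pose f (i : 'I_#|K6_vertex V m|) := K6_vector R Phi (enum_val i).
  exists (\matrix_(i, j) \sum_t f i t * f j t).
    by split=> [|i]; [apply: psdmx_gram | rewrite mxE K6_vector_unit].
  rewrite sdp_obj_K6 // => [|i]; last by rewrite mxE K6_vector_unit.
  rewrite -sum9; apply: eq_bigr => j _.
  rewrite [X in _ * X](_ : _ = 0) ?mulr0 ?subr0 //.
  under eq_bigr => u _ do under eq_bigr => v _ do
    rewrite mxE /f !enum_rankK.
  by rewrite sum_gram big1 // => t _; rewrite K6_vector_sum0 expr0n.
move=> _ [X [psdX X1] <-]; rewrite sdp_obj_K6 // -sum9; apply: ler_sum => j _.
by have := psdmx_sum_ge0 (K6_block Phi j) psdX; lra.
Qed.

(** * The cut value *)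

(** A cut is a rank-one feasible point of the semidefinite program. *)
Lemma cut_obj_K6 (R : realType) (V : finType) (m : nat)
    (Phi : nae4sat V m) (linPhi : linear_inst Phi)
    (x : 'rV[R]_#|K6_vertex V m|) (x1 : forall i, x 0 i = -1 \/ x 0 i = 1) :
  cut_obj (adjmx R (K6_graph Phi)) x =
    \sum_j (9 - 4^-1 * (\sum_(u in K6_block Phi j) x 0 (enum_rank u)) ^+ 2).
Proof.
transitivity (sdp_obj (adjmx R (K6_graph Phi))
                      (\matrix_(i, j) (x 0 i * x 0 j))).
  congr (_ * _); apply: eq_bigr => i _; apply: eq_bigr => j _.
  by congr (_ * (1 - _)); rewrite mxE.
rewrite sdp_obj_K6 // => [|i]; last by rewrite mxE; case: (x1 i) => ->; lra.
apply: eq_bigr => j _; congr (_ - _ * _).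
rewrite expr2 mulr_suml; apply: eq_bigr => u _; rewrite mulr_sumr.
by apply: eq_bigr => v _; rewrite mxE.
Qed.

Lemma nae_satE (V : finType) (a : {ffun V -> bool}) (C : {set V}) :
  nae_sat a C = (0 < #|C :&: [set v | a v]| < #|C|)%N.
Proof.
have key b : [forall v in C, a v == b] =
    if b then C \subset [set v | a v] else C :&: [set v | a v] == set0.
  case: b.
    apply/forall_inP/subsetP => [h v /h|h v /h]; first by rewrite inE => /eqP.
    by rewrite inE => ->.
  rewrite setI_eq0 disjoint_subset.
  apply/forall_inP/subsetP => [h v /h|h v /h]; first by rewrite !inE => /eqP->.
  by rewrite !inE => /negbTE->.
have -> : (#|C :&: [set v | a v]| < #|C|)%N = ~~ (C \subset [set v | a v]).
  rewrite (ltn_leqif (subset_leqif_cards (subsetIl _ _))).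
  by rewrite (sameP eqP setIidPl).
rewrite card_gt0 -negb_or /nae_sat; congr (~~ _).
apply/existsP/orP => [[[]]|[]]; rewrite ?key; [by right|by left|..] => h.
  by exists false; rewrite key.
by exists true; rewrite key.
Qed.

Definition sign_of (R : pzRingType) (b : bool) : R := if b then 1 else -1.

Lemma sum_sign (R : comNzRingType) (V : finType) (a : {ffun V -> bool})
    (C : {set V}) :
  \sum_(v in C) sign_of R (a v) = #|C :&: [set v | a v]|%:R *+ 2 - #|C|%:R.
Proof.
rewrite (eq_bigr (fun v => (a v)%:R *+ 2 - 1)) => [|v _]; last first.
  by rewrite /sign_of; case: (a v) => /=; ring.
rewrite sumrB sumrMnl sumr_const -natr_sum; congr (_%:R *+ 2 - _).
rewrite -sum1_card; under [RHS]eq_bigl do rewrite !inE.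
by rewrite [RHS]big_mkcondr; apply: eq_bigr => v _; case: (a v).
Qed.

(** If all four variables agree they sum to -4 or 4, and two more signs cannot
    bring the absolute value below 2. *)
Lemma block_sum_sqr_ge (R : realType) (V : finType) (a : {ffun V -> bool})
    (C : {set V}) (b0 b1 : bool) : #|C| = 4%N ->
  4 * (1 - (nae_sat a C)%:R) <=
    (\sum_(v in C) sign_of R (a v) + (sign_of R b0 + sign_of R b1)) ^+ 2.
Proof.
move=> C4; rewrite sum_sign nae_satE C4.
have := subset_leq_card (subsetIl C [set v | a v]); rewrite C4.
move: #|_| => k; case: b0 b1 => [] [] //; rewrite /sign_of.
all: by case: k => [|[|[|[|[|k]]]]] //= _; rewrite ?expr2; lra.
Qed.

(** With k true variables, both private vertices are positive for k < 2, they
    are opposite for k = 2, and both are negative for k > 2. *)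
Definition balancing_bit (V : finType) (a : {ffun V -> bool}) (C : {set V})
    (i : 'I_2) : bool :=
  (#|C :&: [set v | a v]| <= 2 - i)%N.

(** The block sums for k = 0, 1, 2, 3, 4 true variables are -2, 0, 0, 0, 2. *)
Lemma block_sum_balanced (R : realType) (V : finType) (a : {ffun V -> bool})
    (C : {set V}) : #|C| = 4%N ->
  (\sum_(v in C) sign_of R (a v) +
    (sign_of R (balancing_bit a C ord0) +
     sign_of R (balancing_bit a C ord_max))) ^+ 2 = 4 * (1 - (nae_sat a C)%:R).
Proof.
move=> C4; rewrite sum_sign nae_satE C4 /balancing_bit.
have := subset_leq_card (subsetIl C [set v | a v]); rewrite C4.
move: #|_| => k.
by case: k => [|[|[|[|[|k]]]]] //= _; rewrite /sign_of /= ?expr2; lra.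
Qed.

Lemma sum_nae_sat (R : pzSemiRingType) (V : finType) (m : nat)
    (Phi : nae4sat V m) (a : {ffun V -> bool}) :
  \sum_j (nae_sat a (Phi j))%:R = #|[set j | nae_sat a (Phi j)]|%:R :> R.
Proof. 
rewrite -natr_sum -sum1_card; congr _%:R; rewrite [RHS]big_mkcond.
by apply: eq_bigr => j _; rewrite inE; case: nae_sat. Qed.

Lemma OPT_attained (V : finType) (m : nat) (Phi : nae4sat V m) :
  exists a : {ffun V -> bool}, OPT_NAE Phi = #|[set j | nae_sat a (Phi j)]|.
Proof.
have [|a opt_a] := @bigop.eq_bigmax {ffun V -> bool}
  (fun a => #|[set j | nae_sat a (Phi j)]|); last by exists a.
by apply/card_gt0P; exists [ffun=> true].
Qed.

Lemma MC_K6 (R : realType) (V : finType) (m : nat)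
    (Phi : nae4sat V m) (linPhi : linear_inst Phi) :
  MC R (K6_graph Phi) = 8 * m%:R + (OPT_NAE Phi)%:R.
Proof.
have sum_val (a : {ffun V -> bool}) : \sum_(j < m) (8 + (nae_sat a (Phi j))%:R) =
    8 * m%:R + #|[set j | nae_sat a (Phi j)]|%:R :> R.
  by rewrite big_split /= sumr_const card_ord mulr_natr sum_nae_sat.
apply: set_maxP.
  (* Cut along an optimal assignment, with balanced private vertices. *)
  have [a ->] := OPT_attained Phi.
  pose y (u : K6_vertex V m) := match u with
    | inl v => a v
    | inr (j, i) => balancing_bit a (Phi j) i
    end.
  pose x : 'rV[R]_#|K6_vertex V m| := \row_i sign_of R (y (enum_val i)).
  have x1 i : x 0 i = -1 \/ x 0 i = 1.
    by rewrite mxE /sign_of; case: (y _); [right | left].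
  exists x => //; rewrite cut_obj_K6 // -sum_val; apply: eq_bigr => j _.
  under eq_bigr do rewrite mxE enum_rankK.
  rewrite sum_K6_block /= block_sum_balanced ?card_clause //; lra.
(* Conversely, read off an assignment from the signs of the variables. *)
move=> _ [x x1 <-].
pose y u := x 0 (enum_rank u) == 1.
have xE u : x 0 (enum_rank u) = sign_of R (y u).
  rewrite /y /sign_of; case: (x1 (enum_rank u)) => ->; rewrite ?eqxx //.
  by case: eqP => // h; lra.
pose a := [ffun v => y (inl v)].
apply: (@le_trans _ _ (8 * m%:R + #|[set j | nae_sat a (Phi j)]|%:R)); last first.
  by rewrite lerD2l ler_nat; apply: (bigop.leq_bigmax a).
rewrite cut_obj_K6 // -sum_val; apply: ler_sum => j _.
under eq_bigr do rewrite xE.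
rewrite sum_K6_block.
have := block_sum_sqr_ge R a (y (inr (j, ord0))) (y (inr (j, ord_max)))
  (card_clause Phi j).
under eq_bigr do rewrite ffunE.
lra.
Qed.

Lemma OPT_NAE_satisfiable (V : finType) (m : nat) (Phi : nae4sat V m) :
  OPT_NAE Phi = m <-> satisfiable Phi.
Proof.
split=> [optm|[a sata]].
  have [a] := OPT_attained Phi; rewrite optm => card_sat; exists a => j.
  have : [set j | nae_sat a (Phi j)] = setT.
    by apply/eqP; rewrite eqEcard subsetT cardsT card_ord -card_sat leqnn.
  by move/setP/(_ j); rewrite !inE.
have le_m (b : {ffun V -> bool}) : (#|[set j | nae_sat b (Phi j)]| <= m)%N.
  by rewrite -[leqRHS]card_ord; apply: max_card.
apply/eqP; rewrite eqn_leq; apply/andP; split; first by apply/bigop.bigmax_leqP.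
apply: leq_trans (bigop.leq_bigmax a); rewrite -[leqLHS]card_ord -cardsT.
by apply: subset_leq_card; apply/subsetP => j _; rewrite inE.
Qed.

Theorem mainTheorem3 (R : realType) (V : finType) (m : nat)
    (Phi : nae4sat V m) (m_ge1 : (1 <= m)%N) (linPhi : linear_inst Phi) :
  [/\ SDP R (K6_graph Phi) = 9 * m%:R,
      MC R (K6_graph Phi) = 8 * m%:R + (OPT_NAE Phi)%:R,
      SDP R (K6_graph Phi) - MC R (K6_graph Phi) = m%:R - (OPT_NAE Phi)%:R
    & SDP R (K6_graph Phi) = MC R (K6_graph Phi) <-> satisfiable Phi].
Proof.
rewrite SDP_K6 // MC_K6 //; split=> //; first by ring.
rewrite -OPT_NAE_satisfiable; split=> [eq_val|->]; last by ring.
by apply/eqP; rewrite -(eqr_nat R); apply/eqP; lra.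
Qed.
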